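(* Let $I$ be an infinite set and let $\{X_i\}_{i\in I}$ be a family of non-zero complex vector spaces. Then $$\bigotimes_{i\in I} X_i \;=\; \bigoplus_{\omega\in \Omega_{I;X}} \bigotimes_{i\in I}^{\omega} X_i$$ (an internal direct sum of vector subspaces of $\bigotimes_{i\in I}X_i$).
   Context: A map $\Phi:\prod_{i\in I}X_i\to Y$ into a vector space $Y$ is multilinear if it is linear in each variable separately. The tensor product of $\{X_i\}_{i\in I}$ is a pair $(\bigotimes_{i\in I}X_i,\Theta_X)$ consisting of a vector space and a multilinear map $\Theta_X:\prod_{i\in I}X_i\to\bigotimes_{i\in I}X_i$ such that for every vector space $Y$ and every multilinear map $\Phi:\prod_{i\in I}X_i\to Y$ there is a unique linear map $\tilde\Phi:\bigotimes_{i\in I}X_i\to Y$ with $\Phi=\tilde\Phi\circ\Theta_X$; it exists and is unique up to canonical isomorphism. Put $X_i^\times=X_i\setminus\{0\}$. For $x,y\in\prod_{i\in I}X_i^\times$ write $x\sim y$ if $x_i=y_i$ for all but finitely many $i\in I$; this is an equivalence relation, and $\Omega_{I;X}$ denotes the set of its equivalence classes $[x]_\sim$. For $u\in\prod_{i\in I}X_i^\times$ let $\prod^u_{i\in I}X_i=\{x\in\prod_{i\in I}X_i: x_i=u_i\text{ for all but finitely many }i\}$ and $\bigotimes^u_{i\in I}X_i=\mathrm{span}\,\Theta_X(\prod^u_{i\in I}X_i)$. This depends only on $\omega=[u]_\sim$, and is also written $\bigotimes^{\omega}_{i\in I}X_i$. *)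

(* Defs.v *)
From HB Require Import structures.
From mathcomp Require Import all_boot all_order all_algebra.
From mathcomp Require Import generic_quotient complex.
From mathcomp Require Import all_classical all_reals.
Set Implicit Arguments.
Unset Strict Implicit.
Unset Printing Implicit Defensive.
Import GRing.Theory.
Local Open Scope classical_set_scope.
Local Open Scope ring_scope.
Local Open Scope quotient_scope.

Section Subspaces.
Variables (K : fieldType) (V : lmodType K).

Definition subspace (S : set V) : Prop := submod_closed [in S].

Definition lin_span (S : set V) : set V := smallest subspace S.

(* The sum over [setT] is the library's finitely supported sum (it is 0 by
   convention on an infinite support), so finiteness of the support has to be
   required separately. *)
Definition internal_direct_sum (J : choiceType) (W : J -> set V) : Prop :=
  (forall j, subspace (W j)) /\
  forall t : V, exists! v : J -> V,
    [/\ forall j, W j (v j),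
        finite_set [set j | v j != 0] &
        t = \sum_(j \in [set: J]) v j].
End Subspaces.

Section Tensor.
Variables (K : fieldType) (I : Type) (X : I -> lmodType K).

(* [{classic I}] is [I] with its classical decidable equality: the argument of
   [Phi] is [x] with its [i]-th coordinate replaced by [t]. *)
Definition multilinear (Y : lmodType K) (Phi : (forall i, X i) -> Y) : Prop :=
  forall (i : I) (x : forall i, X i),
    linear (fun t : X i => Phi (@dfwith {classic I} X x i t)).

Definition is_tensor_product (T : lmodType K) (Theta : (forall i, X i) -> T) :
    Prop :=
  multilinear Theta /\
  forall (Y : lmodType K) (Phi : (forall i, X i) -> Y), multilinear Phi ->
    exists! f : {linear T -> Y}, forall x, Phi x = f (Theta x).

Definition almost_eq (x y : forall i, X i) : Prop :=
  finite_set [set i | x i != y i].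

Lemma almost_eq_refl x : almost_eq x x.
Proof.
rewrite /almost_eq (_ : [set _ | _] = set0) //.
by apply/seteqP; split=> i //=; rewrite eqxx.
Qed.

Lemma almost_eq_sym x y : almost_eq x y -> almost_eq y x.
Proof. by apply: sub_finite_set => i /=; rewrite eq_sym. Qed.

Lemma almost_eq_trans x y z : almost_eq x y -> almost_eq y z -> almost_eq x z.
Proof.
move=> xy yz; apply: (@sub_finite_set _ _
  ([set i | x i != y i] `|` [set i | y i != z i])); last first.
  by rewrite finite_setU.
by move=> i /=; have [->|] := eqVneq (x i) (y i); [right|left].
Qed.

Definition nzfam := forall i, {v : X i | v != 0}.
HB.instance Definition _ := Choice.copy nzfam (forall i, {v : X i | v != 0}).

Definition nzval (u : nzfam) : forall i, X i := fun i => val (u i).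

Definition nzfam_eqb (u v : nzfam) : bool := `[< almost_eq (nzval u) (nzval v) >].

Lemma nzfam_eqb_equiv : equiv_class_of nzfam_eqb.
Proof.
split=> [u|u v|v u w]; first exact/asboolP/almost_eq_refl.
  by apply/asboolP/asboolP; exact: almost_eq_sym.
by move=> /asboolP uv /asboolP vw; apply/asboolP; exact: almost_eq_trans vw.
Qed.

Canonical nzfam_equiv : equiv_rel nzfam := EquivRelPack nzfam_eqb_equiv.

Definition Omega := {eq_quot nzfam_equiv}.
HB.instance Definition _ := Choice.on Omega.
HB.instance Definition _ := EqQuotient.on Omega.

Variables (T : lmodType K) (Theta : (forall i, X i) -> T).

Definition tensor_at (u : nzfam) : set T :=
  lin_span (Theta @` [set x | almost_eq x (nzval u)]).

Lemma tensor_at_eq (u v : nzfam) :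
  almost_eq (nzval u) (nzval v) -> tensor_at u = tensor_at v.
Proof.
move=> uv; congr (lin_span (_ @` _)); apply/seteqP; split=> x /= xu.
  exact: almost_eq_trans xu uv.
exact: almost_eq_trans xu (almost_eq_sym uv).
Qed.

Definition tensor_class (w : Omega) : set T := tensor_at (repr w).

Lemma tensor_class_pi (u : nzfam) : tensor_class (\pi_Omega u) = tensor_at u.
Proof.
apply: tensor_at_eq; apply/asboolP.
rewrite -/(nzfam_equiv _ _).
by apply/(eqmodP nzfam_equiv); rewrite reprK.
Qed.
End Tensor.

(* Main.v *)
(* For each class [w], the map sending [x] to [Theta x] if [x] is almost equal
   to a representative of [w] and to [0] otherwise is multilinear, because
   changing one coordinate does not change almost equality. It therefore factors
   through an endomorphism [P w] of [T], which is the identity on the summand of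
   [w] and [0] on the other summands; this forces the [w]-component of [t] to be
   [P w t]. The vectors that are the finitely supported sum of their [P w]-images
   form a subspace containing the range of [Theta], hence all of [T]. *)
Require Import Defs.
From HB Require Import structures.
From mathcomp Require Import all_boot all_order all_algebra.
From mathcomp Require Import finmap generic_quotient complex.
From mathcomp Require Import all_classical all_reals.
Set Implicit Arguments.
Unset Strict Implicit.
Unset Printing Implicit Defensive.
Import GRing.Theory.
Local Open Scope classical_set_scope.
Local Open Scope ring_scope.
Local Open Scope quotient_scope.

Section Span.
Variables (K : fieldType) (V : lmodType K).

Lemma subspaceP (S : set V) :
  S 0 -> (forall a u v, S u -> S v -> S (a *: u + v)) -> subspace S.
Proof.
move=> S0 SD; split; first exact/mem_set.
by move=> a u v /set_mem Su /set_mem Sv; apply/mem_set; exact: SD.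
Qed.

Lemma subspace0 (S : set V) : subspace S -> S 0.
Proof. by case=> /set_mem. Qed.

Lemma subspaceD (S : set V) a u v : subspace S -> S u -> S v -> S (a *: u + v).
Proof. by case=> _ SD Su Sv; apply/set_mem/SD; exact/mem_set. Qed.

Lemma lin_span_subspace (S : set V) : subspace (lin_span S).
Proof.
apply: subspaceP => [A [sA _]|a u v Su Sv A sA]; first exact: subspace0.
by apply: subspaceD; [exact: sA.1|exact: Su|exact: Sv].
Qed.

Lemma sub_lin_span (S : set V) : S `<=` lin_span S.
Proof. by move=> x Sx A [_]; exact. Qed.

Lemma lin_span_min (S A : set V) : subspace A -> S `<=` A -> lin_span S `<=` A.
Proof. by move=> sA SA x; apply. Qed.

Lemma lin_span_eq (W : lmodType K) (f g : {linear V -> W}) (S : set V) :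
  (forall x, S x -> f x = g x) -> forall x, lin_span S x -> f x = g x.
Proof.
move=> fg; apply: lin_span_min => //; apply: subspaceP => /= [|a u v fu fv].
  by rewrite !linear0.
by rewrite !linearP fu fv.
Qed.

(** The universal property speaks of modules only, so a subspace has to become a type to serve as
    its target. The closure proof is a parameter so that the module structure can be inferred from
    the type. *)
Definition submod (S : set V) of subspace S := {t : V | t \in S}.

Section Submodule.
Variables (S : set V) (sS : subspace S).
HB.instance Definition _ := SubChoice.on (submod sS).

Fact submod_subproof : GRing.subsemimod_closed (fun t : V => t \in S).
Proof. exact: GRing.submod_closed_semi. Qed.

HB.instance Definition _ := GRing.SubChoice_isSubLmodule.Build K V
  (fun t => t \in S) (submod sS) submod_subproof.

Definition submod_val : {linear submod sS -> V} := val.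
End Submodule.
End Span.

Section Tensor.
Variables (K : fieldType) (I : Type) (X : I -> lmodType K).

Lemma almost_eq_dfwith (x : forall i, X i) i (s t : X i) :
  almost_eq (@dfwith {classic I} X x i s) (@dfwith {classic I} X x i t).
Proof.
apply: (@sub_finite_set _ _ [set i]); last exact: finite_set1.
move=> j /=; case: (eqVneq (j : {classic I}) i) => // ji.
by rewrite !dfwithout ?eqxx // eq_sym.
Qed.

(** Links equality of classes with the condition that defines the generators of [tensor_class],
    which mentions only the chosen representative. *)
Lemma almost_eq_Omega (u : nzfam X) (w : Omega X) :
  almost_eq (nzval u) (nzval (repr w)) <-> w = \pi_(Omega X) u.
Proof.
split=> [uw|->].
  rewrite -[w]reprK; apply/(eqmodP (nzfam_equiv X))/asboolP.
  exact: almost_eq_sym.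
apply/asboolP; rewrite -/(nzfam_equiv _ _ _).
by apply/(eqmodP (nzfam_equiv X)); rewrite reprK.
Qed.

Lemma multilinear_eq0 (Y : lmodType K) (Phi : (forall i, X i) -> Y) x i :
  multilinear Phi -> x i = 0 -> Phi x = 0.
Proof.
move=> /(_ i x) lPhi xi0.
have <- : @dfwith {classic I} X x i 0 = x.
  apply/functional_extensionality_dep => j.
  by case: (@dfwithP {classic I} X x i 0 j).
(* Since -1 *: 0 + 0 = 0, linearity gives f 0 = - f 0 + f 0 = 0. *)
have := lPhi (-1) 0 0.
by rewrite scaleN1r oppr0 addr0 scaleN1r addNr.
Qed.

Variables (T : lmodType K) (Theta : (forall i, X i) -> T).
Hypothesis T_tensor : is_tensor_product Theta.

(* Corestricting [Theta] to [S] gives a linear map [T -> S] whose composite with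
   the inclusion fixes [Theta], hence is the identity. *)
Lemma tensor_ind (S : set T) :
  subspace S -> (forall x, S (Theta x)) -> forall t, S t.
Proof.
move=> sS STheta.
pose Phi x : submod sS := exist _ (Theta x) (mem_set (STheta x)).
have mPhi : multilinear Phi.
  by move=> i x a s t; apply: val_inj; exact: T_tensor.1.
have [f [fPhi _]] := T_tensor.2 _ _ mPhi.
have [g [_ g_unique]] := T_tensor.2 _ _ T_tensor.1.
have gid : g = idfun by exact: g_unique.
have gf : g = (submod_val sS \o f)%FUN by apply: g_unique => x; rewrite /= -fPhi.
have vf t : val (f t) = t.
  by transitivity (g t); [rewrite gf|rewrite gid].
move=> t; rewrite -[t]vf.
exact/set_mem/valP.
Qed.

End Tensor.

Section FiniteSupportSum.
Variables (K : fieldType) (V : lmodType K) (J : choiceType).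

Lemma fsum_only (v : J -> V) j :
  (forall i, i != j -> v i = 0) -> \sum_(i \in [set: J]) v i = v j.
Proof.
move=> v0; rewrite (fsbigTE [fset j]%fset) ?big_seq_fset1 // => i.
by rewrite inE; exact: v0.
Qed.

Lemma fsum_support (A : set J) (v : J -> V) : finite_set A ->
  [set j | v j != 0] `<=` A ->
  \sum_(j \in [set: J]) v j = \sum_(j <- fset_set A) v j.
Proof.
move=> finA vA; apply: fsbigTE => j; apply: contraNeq => vj.
by rewrite in_fset_set // mem_set //; exact: vA.
Qed.

(** Finiteness is asked of [v], not of its image: [f] may kill all but finitely many terms of an
    infinite family, whose own sum is 0 by convention. *)
Lemma linear_fsum (W : lmodType K) (f : {linear V -> W}) (v : J -> V) :
  finite_set [set j | v j != 0] ->
  f (\sum_(j \in [set: J]) v j) = \sum_(j \in [set: J]) f (v j).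
Proof.
move=> finv; rewrite [in LHS](fsum_support finv) // linear_sum; apply/esym/fsbigTE => j.
rewrite in_fset_set // notin_setE /= => /negP; rewrite negbK => /eqP ->.
by rewrite linear0.
Qed.

Lemma finite_support_linear (a : K) (u v : J -> V) :
  finite_set [set j | u j != 0] -> finite_set [set j | v j != 0] ->
  finite_set [set j | a *: u j + v j != 0].
Proof.
move=> finu finv; apply: (@sub_finite_set _ _
  ([set j | u j != 0] `|` [set j | v j != 0])); last by rewrite finite_setU.
move=> j /=; have [->|] := eqVneq (u j) 0; last by left.
by rewrite scaler0 add0r; right.
Qed.

Lemma fsum_linear (a : K) (u v : J -> V) :
  finite_set [set j | u j != 0] -> finite_set [set j | v j != 0] ->
  \sum_(j \in [set: J]) (a *: u j + v j) =
  a *: (\sum_(j \in [set: J]) u j) + \sum_(j \in [set: J]) v j.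
Proof.
move=> finu finv.
(* The union of the two supports is a common finite index set for all three sums. *)
have finuv : finite_set ([set j | u j != 0] `|` [set j | v j != 0]).
  by rewrite finite_setU.
have uA : [set j | u j != 0] `<=` _ := @subsetUl _ _ [set j | v j != 0].
have vA : [set j | v j != 0] `<=` _ := @subsetUr _ [set j | u j != 0] _.
rewrite (fsum_support finuv uA) (fsum_support finuv vA) scaler_sumr -big_split.
apply: fsum_support => // j /=.
by have [->|] := eqVneq (u j) 0; [rewrite scaler0 add0r; right|left].
Qed.
End FiniteSupportSum.

Section Projections.
Variables (K : fieldType) (I : Type) (X : I -> lmodType K).
Variables (T : lmodType K) (Theta : (forall i, X i) -> T).
Hypothesis T_tensor : is_tensor_product Theta.

Definition class_part (w : Omega X) (x : forall i, X i) : T :=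
  if `[< almost_eq x (nzval (repr w)) >] then Theta x else 0.

Lemma class_part_multilinear w : multilinear (class_part w).
Proof.
move=> i x.
have eq_cond s t :
    `[< almost_eq (@dfwith {classic I} X x i s) (nzval (repr w)) >] =
    `[< almost_eq (@dfwith {classic I} X x i t) (nzval (repr w)) >].
  by apply/asboolP/asboolP; apply: almost_eq_trans; exact: almost_eq_dfwith.
(* All three tests become the one with [i]-th coordinate 0, so a single case split settles them
   together. *)
move=> a s t; rewrite /class_part (eq_cond s 0) (eq_cond t 0) (eq_cond _ 0).
case: ifP => _; first exact: T_tensor.1.
by rewrite scaler0 addr0.
Qed.

Lemma class_proj_ex (w : Omega X) :
  {p : {linear T -> T} | forall x, class_part w x = p (Theta x)}.
Proof.
apply/cid; have [p [pE _]] := T_tensor.2 _ _ (class_part_multilinear w).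
by exists p.
Qed.

Definition class_proj w : {linear T -> T} := sval (class_proj_ex w).

Lemma class_projE w x : class_proj w (Theta x) = class_part w x.
Proof. by rewrite /class_proj; case: class_proj_ex => p /= ->. Qed.

Lemma class_proj_id w t : tensor_class Theta w t -> class_proj w t = t.
Proof.
apply: (@lin_span_eq _ _ _ (class_proj w) idfun) => _ [x /= xw <-].
by rewrite class_projE /class_part; case: asboolP.
Qed.

Lemma class_proj_eq0 w w' t :
  w' != w -> tensor_class Theta w t -> class_proj w' t = 0.
Proof.
move=> ww'; apply: (@lin_span_eq _ _ _ (class_proj w') \0) => _ [x /= xw <-].
rewrite class_projE /class_part; case: asboolP => // xw'.
case/eqP: ww'; rewrite -[w]reprK; apply/almost_eq_Omega.
exact: almost_eq_trans (almost_eq_sym xw) xw'.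
Qed.

(** The universal property says nothing about the range of [class_proj w]. That it lies in the
    summand of [w] is therefore carried along as the first clause and proved for all of [T] by the
    same induction. *)
Definition proj_decomposable : set T := [set t |
  [/\ forall w, tensor_class Theta w (class_proj w t),
      finite_set [set w | class_proj w t != 0] &
      t = \sum_(w \in [set: Omega X]) class_proj w t]].

Lemma proj_decomposable_subspace : subspace proj_decomposable.
Proof.
apply: subspaceP => [|a u v [uW finu uE] [vW finv vE]].
  split=> [w||].
  - by rewrite linear0; exact: subspace0 (lin_span_subspace _).
  - rewrite (_ : [set _ | _] = set0) //.
    by apply/seteqP; split=> w //=; rewrite linear0 eqxx.
  - by rewrite fsbig1 // => w _; rewrite linear0.
split=> [w||].
- by rewrite linearP; exact: subspaceD (lin_span_subspace _) (uW w) (vW w).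
- have := finite_support_linear a finu finv; congr finite_set.
  by apply/seteqP; split=> w /=; rewrite linearP.
- rewrite [in LHS]uE [in LHS]vE -fsum_linear //.
  by apply: eq_fsbigr => w _; rewrite linearP.
Qed.

Lemma tensor_class_decomposable w : tensor_class Theta w `<=` proj_decomposable.
Proof.
move=> t tw; split=> [w'||].
- have [->|w'w] := eqVneq w' w; first by rewrite class_proj_id.
  by rewrite (class_proj_eq0 w'w tw); exact: subspace0 (lin_span_subspace _).
- apply: (@sub_finite_set _ _ [set w]); last exact: finite_set1.
  by move=> w' /=; have [//|w'w] := eqVneq w' w; rewrite (class_proj_eq0 w'w tw) eqxx.
- by rewrite (@fsum_only _ _ _ _ w) ?class_proj_id // => w' /class_proj_eq0 ->.
Qed.

Lemma tensor_decomposable t : proj_decomposable t.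
Proof.
apply: (tensor_ind T_tensor proj_decomposable_subspace) => x.
(* A family with a zero coordinate belongs to no class, but its image under [Theta] is 0; any other
   family lies in its own class. *)
have [[i xi0]|x0] := pselect (exists i, x i = 0).
  rewrite (multilinear_eq0 T_tensor.1 xi0).
  exact: subspace0 proj_decomposable_subspace.
have nz i : x i != 0 by apply/eqP => xi0; apply: x0; exists i.
pose u : nzfam X := fun i => exist _ (x i) (nz i).
apply: (@tensor_class_decomposable (\pi_(Omega X) u)).
by apply: sub_lin_span; exists x => //=; apply/(almost_eq_Omega u).
Qed.

Lemma tensor_class_direct_sum :
  internal_direct_sum (fun w : Omega X => tensor_class Theta w).
Proof.
split=> [w|t]; first exact: lin_span_subspace.
exists (class_proj ^~ t); split; first exact: tensor_decomposable.
move=> v [vW finv tE]; apply/funext => w.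
(* Uniqueness: [class_proj w] fixes the term [v w] of the sum and kills all the others. *)
rewrite tE linear_fsum // (@fsum_only _ _ _ _ w) ?class_proj_id // => w' w'w.
by apply: class_proj_eq0 (vW w'); rewrite eq_sym.
Qed.
End Projections.

Unset Implicit Arguments.

Theorem theorem2p5 (R : realType) (I : Type) (X : I -> lmodType R[i])
    (I_infinite : infinite_set [set: I])
    (X_nonzero : forall i, exists x : X i, x != 0)
    (T : lmodType R[i]) (Theta : (forall i, X i) -> T)
    (T_tensor : is_tensor_product Theta) :
  internal_direct_sum (fun w : Omega X => tensor_class Theta w).
Proof. exact: tensor_class_direct_sum. Qed.
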